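(* Let $l_1,r_1,l_2,r_2,p$ be positive integers with $p>2$, $l_1+r_1<p$, $l_2+r_2<p$. Consider the following conditions: \begin{itemize} \item $(S1)$: $l_1+l_2+r_2\ge p$ or $l_1+r_1+r_2\ge p$; \item $(S2)$: $l_1+r_1+l_2\ge p$ or $r_1+l_2+r_2\ge p$; \item $(S3)$: $l_1+r_1+l_2+r_2\le p$; \item $(S1^* )$: $l_1+l_2+r_2>p$ or $l_1+r_1+r_2>p$; \item $(S2^* )$: $l_1+r_1+l_2>p$ or $r_1+l_2+r_2>p$. \end{itemize} Let $D=C(l_1,r_1,p)-C(l_2,r_2,p)$. Then: \begin{itemize} \item[(1)] $D=[-1,1]$ if and only if $(S1)$ and $(S2)$ hold. \item[(2)] $D$ is a Cantor set if and only if $(S3)$ holds. \item[(3)] $D$ is an L-Cantorval if and only if $(S1^* )$ holds, but $(S2)$ does not hold. \item[(4)] $D$ is an R-Cantorval if and only if $(S2^* )$ holds, but $(S1)$ does not hold. \item[(5)] $D$ is an M-Cantorval if and only if $(S1^* )$, $(S2^* )$, $(S3)$ do not hold and at least one of $(S1)$ or $(S2)$ also does not hold. \end{itemize}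
   Context: For $A,B\subset\mathbb{R}$, $A-B=\{a-b: a\in A,\ b\in B\}$. For a finite set $A\subset\mathbb{Z}$ and an integer $p\ge 2$, $A_p:=\left\{\sum_{i=1}^{\infty}\frac{x_i}{p^i}: x_i\in A\right\}$. For integers $i\le j$, $\langle i,j\rangle:=[i,j]\cap\mathbb{Z}$, and $\langle i,j\rangle:=\emptyset$ if $i>j$. For positive integers $l,r,p$ with $p>2$, $l+r<p$, put $A(l,r,p):=\langle 0,l-1\rangle\cup\langle p-r,p-1\rangle$ and $C(l,r,p):=A(l,r,p)_p$. A set $C\subset\mathbb{R}$ is a Cantor set if it is nonempty, compact, perfect and nowhere dense. For a set $C\subset\mathbb{R}$, every component of $\mathbb{R}\setminus C$ is called a gap of $C$; a component of $C$ is called proper if it is not a singleton. A perfect set $E\subset\mathbb{R}$ is called an M-Cantorval if it has infinitely many gaps and both endpoints of any gap are accumulated by gaps and proper components of $E$ (i.e. every neighbourhood of the endpoint contains infinitely many gaps and infinitely many proper components of $E$). A perfect set $E\subset\mathbb{R}$ is called an L-Cantorval (respectively, an R-Cantorval) if it has infinitely many gaps, the left (respectively, right) endpoint of any gap is accumulated by gaps and proper components of $E$, and the right (respectively, left) endpoint of any gap is an endpoint of a proper component of $E$. (For an unbounded gap only its finite endpoint is considered.) *)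

(* Defs.v *)
From HB Require Import structures.
From mathcomp Require Import all_boot all_order all_algebra.
From mathcomp Require Import all_classical all_reals all_analysis.

Set Implicit Arguments.
Unset Strict Implicit.
Unset Printing Implicit Defensive.

Import Order.TTheory GRing.Theory Num.Theory.
Import numFieldNormedType.Exports.

Local Open Scope classical_set_scope.
Local Open Scope ring_scope.

Definition diff_set (R : realType) (A B : set R) : set R :=
  [set a - b | a in A & b in B].

Definition int_itv (i j : int) : set int := [set n | i <= n <= j].

(* The sequence of digits is indexed from 0: [x i] is the coefficient of
   [p ^ -(i + 1)]. *)
Definition radix_set (R : realType) (A : set int) (p : nat) : set R :=
  [set s | exists x : nat -> int, (forall i, A (x i)) /\
     series (fun i => (x i)%:~R / p%:R ^+ i.+1 : R) @ \oo --> s].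

(* All subtractions take place in [int]. *)
Definition digits (l r p : nat) : set int :=
  int_itv 0 (l%:Z - 1) `|` int_itv (p%:Z - r%:Z) (p%:Z - 1).

Definition Cset (R : realType) (l r p : nat) : set R :=
  radix_set (digits l r p) p.

Arguments Cset : clear implicits.

Definition nowhere_dense (R : realType) (C : set R) : Prop :=
  interior (closure C) = set0.

Definition is_Cantor_set (R : realType) (C : set R) : Prop :=
  [/\ C !=set0, compact C, perfect_set C & nowhere_dense C].

Definition components (R : realType) (A : set R) : set (set R) :=
  [set connected_component A x | x in A].

Definition gaps (R : realType) (C : set R) : set (set R) := components (~` C).

Definition proper_components (R : realType) (C : set R) : set (set R) :=
  [set K | components C K /\ ~ exists x, K = [set x]].

(* [inf] and [sup] are junk values on unbounded sets, hence the [has_inf] and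
   [has_sup] guards: only finite endpoints are considered. *)
Definition left_endpoint (R : realType) (I : set R) (a : R) : Prop :=
  has_inf I /\ a = inf I.

Definition right_endpoint (R : realType) (I : set R) (a : R) : Prop :=
  has_sup I /\ a = sup I.

Definition endpoint (R : realType) (I : set R) (a : R) : Prop :=
  left_endpoint I a \/ right_endpoint I a.

Definition clusters_at (R : realType) (F : set (set R)) (a : R) : Prop :=
  forall U : set R, nbhs a U -> infinite_set [set K | F K /\ K `<=` U].

Definition gaps_and_components_cluster_at (R : realType) (E : set R) (a : R) : Prop :=
  clusters_at (gaps E) a /\ clusters_at (proper_components E) a.

Definition ends_proper_component (R : realType) (E : set R) (a : R) : Prop :=
  exists2 K, proper_components E K & endpoint K a.

Definition is_M_Cantorval (R : realType) (E : set R) : Prop :=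
  [/\ perfect_set E, infinite_set (gaps E) &
      forall G a, gaps E G -> endpoint G a ->
        gaps_and_components_cluster_at E a].

Definition is_L_Cantorval (R : realType) (E : set R) : Prop :=
  [/\ perfect_set E, infinite_set (gaps E),
      forall G a, gaps E G -> left_endpoint G a ->
        gaps_and_components_cluster_at E a &
      forall G a, gaps E G -> right_endpoint G a -> ends_proper_component E a].

Definition is_R_Cantorval (R : realType) (E : set R) : Prop :=
  [/\ perfect_set E, infinite_set (gaps E),
      forall G a, gaps E G -> right_endpoint G a ->
        gaps_and_components_cluster_at E a &
      forall G a, gaps E G -> left_endpoint G a -> ends_proper_component E a].

Definition S1 (l1 r1 l2 r2 p : nat) : Prop :=
  (l1 + l2 + r2 >= p)%N \/ (l1 + r1 + r2 >= p)%N.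

Definition S2 (l1 r1 l2 r2 p : nat) : Prop :=
  (l1 + r1 + l2 >= p)%N \/ (r1 + l2 + r2 >= p)%N.

Definition S3 (l1 r1 l2 r2 p : nat) : Prop :=
  (l1 + r1 + l2 + r2 <= p)%N.

Definition S1star (l1 r1 l2 r2 p : nat) : Prop :=
  (l1 + l2 + r2 > p)%N \/ (l1 + r1 + r2 > p)%N.

Definition S2star (l1 r1 l2 r2 p : nat) : Prop :=
  (l1 + r1 + l2 > p)%N \/ (r1 + l2 + r2 > p)%N.

(* Main.v *)
Require Import Defs.
From mathcomp Require Import all_boot all_order all_algebra.
From mathcomp Require Import all_classical all_reals all_analysis.
From mathcomp Require Import zify ring lra.

Import Order.TTheory GRing.Theory Num.Theory.
Import numFieldNormedType.Exports.

Local Open Scope classical_set_scope.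
Local Open Scope ring_scope.

Set Implicit Arguments.
Unset Strict Implicit.

(** Write [D] for the difference set. Subtracting expansions termwise shows that
    [D] is the set of expansions in base [p] with digits in the difference [A]
    of the two digit sets ([diff_radix_set]). Put [M = max l1 r2] and
    [N = max l2 r1]. Then [A] consists of three blocks of consecutive integers:
    a left one starting at [1 - p], of length [l1 + r2 - 1]; a middle one from
    [1 - N] to [M - 1]; and a right one ending at [p - 1], of length
    [r1 + l2 - 1] ([diff_digitsP]). The numbers of integers missing between
    left and middle and between middle and right blocks are at most one under
    (S1) and under (S2) respectively, and zero under the starred conditions.

    Two facts about expansions drive everything: [D] is the union of its cells
    [(d + D) / p], [d] in [A] ([radix_setP]), and any bounded set contained in
    the union of its own cells is contained in [D] ([radix_set_coind]). As
    [D] has minimum -1 and maximum 1, cells of digits differing by 2 touch.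
    Hence the interval [-1, 1] satisfies the coinduction principle under (S1)
    and (S2); and [0, 1] does as soon as the middle and right blocks merge,
    all of [0, p - 1] being digits then ([S2star_nonneg]). If an integer is
    missing there, then, outside case (1), the positive part of [D] has a hole:
    directly when two integers are missing ([notS2_hole]), and otherwise next
    to the point where two cells touch, copied from a hole of the negative part
    ([touching_hole]).

    Under (S3) the integer translates of [D] miss a point ([S3_translate]),
    whereas the translates of a piece of [D] blown up by a power of [p] would
    cover the line if [D] contained an interval ([interval_translates]); so [D]
    is a Cantor set. If (S3) fails, then [A] contains a complete residue system
    modulo [p], the integer translates of [D] cover the line, and by a finite
    Baire argument [D] contains an interval ([residues_interval]); by
    self-similarity small intervals are then everywhere in [D].

    A gap of [D] with left endpoint [x], blown up until it is longer than [D],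
    shows that every small cell containing [x] has [x] as its maximum
    ([gap_left_cell]). So [D] looks near [x] as it does near 1, which by zooming
    looks like the positive part of [D]: if [0, 1] lies in [D] then [x] ends an
    interval of [D]; if the positive part has a hole then there are holes of [D]
    arbitrarily close to the left of [x], interleaved with small intervals, so
    gaps and proper components accumulate at [x] ([left_end_clusters]).
    Exchanging the two Cantor sets reflects [D], which settles right endpoints.

    The five conditions exhaust all cases, so it remains to tell the five types
    apart. The gaps on both sides of [D] have the endpoints -1 and 1, and a
    type prescribes at each of them whether it ends a proper component or is a
    limit of gaps and proper components. These are incompatible
    ([max_not_proper_and_clusters]), and neither happens in a Cantor set. *)

(** * Digit expansions *)

Section RadixSet.
Variables (R : realType) (p : nat).
Hypothesis p_gt1 : (1 < p)%N.
Implicit Types (A B : set int) (X : set R) (x : nat -> int) (y z : R).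

Local Notation radix_terms x :=
  (fun i => (x i)%:~R / p%:R ^+ i.+1 : R).

Let p_gt0 : 0 < p%:R :> R. Proof. by rewrite ltr0n; lia. Qed.
Let p_neq0 : p%:R != 0 :> R. Proof. by rewrite gt_eqF. Qed.

Lemma norm_pV_lt1 : `|p%:R^-1 : R| < 1.
Proof.
by rewrite ger0_norm ?invr_ge0 ?ltW// invf_lt1// ltr1n.
Qed.

Lemma is_cvg_radix_series x (b : R) :
  (forall i, `|(x i)%:~R : R| <= b) -> cvgn (series (radix_terms x)).
Proof.
move=> xb; apply: normed_cvg.
apply: (@series_le_cvg _ _ (geometric (b / p%:R) p%:R^-1)) => [n|n|n|].
- exact: normr_ge0.
- have b_ge0 := le_trans (normr_ge0 _) (xb 0%N).
  by rewrite /= mulr_ge0 ?divr_ge0 ?exprn_ge0 ?invr_ge0 ?(ltW p_gt0).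
- rewrite /= exprS normrM normfV normrM normrX (ger0_norm (ltW p_gt0)).
  rewrite invfM exprVn mulrA ler_pM2r ?invr_gt0 ?exprn_gt0//.
  by rewrite ler_pM2r ?invr_gt0.
- exact/is_cvg_geometric_series/norm_pV_lt1.
Qed.

Lemma radix_series_recl x n :
  series (radix_terms x) n.+1 =
  ((x 0%N)%:~R + series (radix_terms (x \o S)) n) / p%:R.
Proof.
rewrite /series/= big_nat_recl//= expr1 mulrDl; congr (_ + _).
rewrite mulr_suml; apply: eq_bigr => i _.
by rewrite [X in _ / X]exprSr invfM mulrA.
Qed.

(** This is the self-similarity equation: the expansions starting with [d] form
    the cell [(d + radix_set A p) / p]. *)
Lemma radix_setP A z :
  radix_set A p z <-> exists2 d, A d & radix_set A p (p%:R * z - d%:~R).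
Proof.
split=> [[x [Ax xz]]|[d Ad [x [Ax xz]]]].
  exists (x 0%N) => //; exists (x \o S); split=> [i|]; first exact: Ax.
  have -> : series (radix_terms (x \o S)) =
      (fun n => p%:R * series (radix_terms x) n.+1 - (x 0%N)%:~R).
    by apply/funext => n; rewrite radix_series_recl mulrC divfK// addrC addKr.
  apply: cvgB; last exact: cvg_cst.
  by apply: cvgM; [exact: cvg_cst | rewrite cvg_shiftS].
pose dx i := if i is j.+1 then x j else d.
exists dx; split; first by case.
rewrite -cvg_shiftS.
have -> : [sequence series (radix_terms dx) n.+1]_n =
    (fun n => (d%:~R + series (radix_terms x) n) / p%:R).
  by apply/funext => n; rewrite /= (radix_series_recl dx).
have -> : z = (d%:~R + (p%:R * z - d%:~R)) / p%:R by field.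
apply: cvgM; last exact: cvg_cst.
by apply: cvgD => //; exact: cvg_cst.
Qed.

(** The coinduction principle for expansions: if stripping a suitable digit
    never leaves the bounded set [X], then after [n] digits the remainder of
    [z \in X] is at most [c / p ^ n], so the stripped digits expand [z]. *)
Lemma radix_set_coind A X (c : R) :
  (forall z, X z -> `|z| <= c) ->
  (forall z, X z -> exists2 d, A d & X (p%:R * z - d%:~R)) ->
  X `<=` radix_set A p.
Proof.
move=> Xc Xstep z Xz.
have /choice[f fP] : forall y, exists d, X y -> A d /\ X (p%:R * y - d%:~R).
  move=> y; have [Xy|nXy] := pselect (X y); last by exists 0.
  by have [d Ad Xd] := Xstep y Xy; exists d.
pose r n := iter n (fun y => p%:R * y - (f y)%:~R) z.
have Xr n : X (r n) by elim: n => //= n /fP[].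
exists (f \o r); split=> [i|]; first by case: (fP _ (Xr i)).
have serE n : series (radix_terms (f \o r)) n = z - r n * p%:R ^- n.
  elim: n => [|n IH]; first by rewrite /series/= big_geq// invr1 mulr1 subrr.
  rewrite seriesEnat/= big_nat_recr//= -[X in X + _]/(series _ n) IH exprS.
  by field; rewrite p_neq0 expf_neq0.
have rle n : `|r n * p%:R ^- n| <= c * p%:R^-1 ^+ n.
  rewrite normrM normfV normrX (ger0_norm (ltW p_gt0)) exprVn.
  by rewrite ler_pM2r ?invr_gt0 ?exprn_gt0//; exact/Xc/Xr.
have c0 : (fun n => c * p%:R^-1 ^+ n) @ \oo --> (0 : R).
  rewrite -[X in _ --> X](mulr0 c); apply: cvgM; first exact: cvg_cst.
  exact/cvg_expr/norm_pV_lt1.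
apply: (@squeeze_cvgr _ _ _ _ (fun n => z - c * p%:R^-1 ^+ n)
                              (fun n => z + c * p%:R^-1 ^+ n)).
- near=> n; have := rle n; rewrite serE ler_norml => /andP[? ?]; lra.
- rewrite -[X in _ --> X]subr0; apply: cvgB => //; exact: cvg_cst.
- rewrite -[X in _ --> X]addr0; apply: cvgD => //; exact: cvg_cst.
Unshelve. all: by end_near. Qed.

Lemma radix_set_bounded A :
  (forall d, A d -> `|d| <= p%:Z - 1) ->
  forall z, radix_set A p z -> -1 <= z <= 1.
Proof.
move=> Ap z [x [Ax xz]]; rewrite -ler_norml.
have ser_le n : forall x, (forall i, A (x i)) ->
    `|series (radix_terms x) n| <= 1.
  elim: n => [|n IH] {Ax xz}x Ax; first by rewrite /series/= big_geq// normr0.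
  rewrite radix_series_recl normrM normfV (ger0_norm (ltW p_gt0)).
  rewrite ler_pdivrMr// mul1r (le_trans (ler_normD _ _))//.
  have := Ap _ (Ax 0%N); rewrite -(ler_int R) intr_norm rmorphB /= -pmulrn.
  have := IH (x \o S) (fun i => Ax i.+1); lra.
have -> : `|z| = lim (`|series (radix_terms x) n| @[n --> \oo]).
  by apply/esym/cvg_lim => //; exact: cvg_norm.
apply: limr_le; first by apply/cvg_ex; exists `|z|; exact: cvg_norm.
by near=> n; exact: ser_le.
Unshelve. all: by end_near. Qed.

Lemma diff_radix_set A B (b : R) :
  (forall d, A d -> `|d%:~R : R| <= b) -> (forall d, B d -> `|d%:~R : R| <= b) ->
  diff_set (radix_set A p) (radix_set B p) =
  radix_set [set c - d | c in A & d in B] p :> set R.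
Proof.
move=> Ab Bb; apply/seteqP; split=> [_ [s [x [Ax xs]] [t [y [By yt]] <-]]|z].
  exists (fun i => x i - y i); split.
    by move=> i; exists (x i) => //; exists (y i).
  have -> : (radix_terms (fun i => x i - y i)) = radix_terms x - radix_terms y.
    by apply/funext => i /=; rewrite rmorphB mulrBl.
  by rewrite seriesD seriesN; exact: cvgB.
move=> [w [ABw wz]].
have /choice[x xP] : forall i, exists c : int * int,
    [/\ A c.1, B c.2 & w i = c.1 - c.2].
  by move=> i; have [c Ac [d Bd <-]] := ABw i; exists (c, d).
have wE : radix_terms w =
    radix_terms (fun i => (x i).1) - radix_terms (fun i => (x i).2).
  by apply/funext => i /=; have [_ _ ->] := xP i; rewrite rmorphB mulrBl.
have c1 : cvgn (series (radix_terms (fun i => (x i).1))).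
  by apply: (is_cvg_radix_series (b := b)) => i; apply: Ab; have [] := xP i.
have c2 : cvgn (series (radix_terms (fun i => (x i).2))).
  by apply: (is_cvg_radix_series (b := b)) => i; apply: Bb; have [] := xP i.
exists (limn (series (radix_terms (fun i => (x i).1)))).
  by exists (fun i => (x i).1); split=> // i; have [] := xP i.
exists (limn (series (radix_terms (fun i => (x i).2)))).
  by exists (fun i => (x i).2); split=> // i; have [] := xP i.
move: wz; rewrite wE seriesD seriesN => wz.
by rewrite -(cvg_lim _ wz)//; apply/esym/cvg_lim => //; exact: cvgB.
Qed.

End RadixSet.

(** * Self-similarity *)

Lemma closed_hole (R : realType) (E : set R) (x : R) :
  closed E -> ~ E x -> exists2 e : R, 0 < e & forall y, `|y - x| < e -> ~ E y.
Proof.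
move=> /closed_openC oE nEx.
have /nbhs_ballP[e /= e0 eE] : nbhs x (~` E) by exact: open_nbhs_nbhs.
by exists e => // y yx; apply: eE; rewrite /ball/= distrC.
Qed.

(** A finite form of the Baire category theorem: a set with empty interior
    stays so after adding finitely many of its closed translates. *)
Lemma closed_translates_interval (R : realType) (E : set R) (s : seq int) :
  closed E -> forall u v : R, u < v ->
  (forall w, u <= w <= v -> exists2 j, j \in s & E (w - j%:~R)) ->
  exists u' v' : R, u' < v' /\ forall y, u' <= y <= v' -> E y.
Proof.
move=> cE; elim: s => [|j s IH] u v uv cov.
  by have [|//] := cov u; rewrite lexx ltW.
have [all_j|] := pselect (forall w, u <= w <= v -> E (w - j%:~R)).
  exists (u - j%:~R), (v - j%:~R); split=> [|y ?]; first lra.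
  by rewrite -(addrK j%:~R y); apply: all_j; lra.
move=> /existsNP[w /not_implyP[uwv nEw]].
have [e e0 eE] := closed_hole cE nEw.
apply: (IH (Num.max u (w - e / 2)) (Num.min v (w + e / 2))).
  by rewrite gt_max !lt_min; apply/andP; split; apply/andP; split; lra.
move=> y; rewrite ge_max le_min => /andP[/andP[uy wy] /andP[yv yw]].
have [|k] := cov y; first lra.
rewrite inE => /predU1P[->|ks] Ek; last by exists k.
by case: (eE (y - j%:~R)) => //; rewrite ltr_norml; lra.
Qed.

Section SelfSimilar.
Variables (R : realType) (p : nat) (A : set int).
Hypothesis p_gt1 : (1 < p)%N.
Hypothesis A_le : forall d, A d -> `|d| <= p%:Z - 1.
Hypothesis A_max : A (p%:Z - 1).
Hypothesis A_min : A (1 - p%:Z).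
Implicit Types (u v w x y z e g : R) (n : nat).

Local Notation D := (radix_set A p : set R).

Let p_gt0 : 0 < p%:R :> R. Proof. by rewrite ltr0n; lia. Qed.
Let pn_gt0 n : 0 < p%:R ^+ n :> R. Proof. by rewrite exprn_gt0. Qed.
Let pZ : p%:Z%:~R = p%:R :> R. Proof. by rewrite -pmulrn. Qed.

Lemma expn_archimedean (c e : R) : 0 < e -> exists n, c < p%:R ^+ n * e.
Proof.
move=> e0; have := @cvg_expr R p%:R^-1 (norm_pV_lt1 _ p_gt1).
have e'0 : 0 < e / (1 + `|c|) by rewrite divr_gt0// ltr_wpDr.
move=> /cvgr0Pnorm_lt /(_ _ e'0)[N _ /(_ N (leqnn N))/=].
rewrite normrX normfV (ger0_norm (ltW p_gt0)) exprVn => lt_e; exists N.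
move: lt_e; rewrite ltr_pdivlMr ?ltr_wpDr// mulrC ltr_pdivrMr// mulrC.
by have := ler_norm c; lra.
Qed.

Lemma radix_set_range z : D z -> -1 <= z <= 1.
Proof. exact: radix_set_bounded. Qed.

Lemma finite_digits : finite_set A.
Proof.
apply: (@sub_finite_set _ _ ((fun i : nat => i%:Z - p%:Z) @` `I_(2 * p))).
  move=> d /A_le dp; exists (absz (d + p%:Z)) => /=; lia.
exact/finite_image/finite_II.
Qed.

Lemma radix_set_max : D 1.
Proof.
suff : [set 1] `<=` D by apply.
apply: (radix_set_coind p_gt1 (c := 1)) => z -> /=; first by rewrite normr1.
by exists (p%:Z - 1) => //; rewrite rmorphB/= pZ; lra.
Qed.

Lemma radix_set_min : D (-1).
Proof.
suff : [set -1] `<=` D by apply.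
apply: (radix_set_coind p_gt1 (c := 1)) => z -> /=; first by rewrite normrN1.
by exists (1 - p%:Z) => //; rewrite rmorphB/= pZ; lra.
Qed.

Lemma continuous_strip (a b : R) : continuous (fun z => a * z - b).
Proof.
move=> z; apply: cvgB; last exact: cvg_cst.
by apply: cvgM; [exact: cvg_cst | exact: cvg_id].
Qed.

Lemma closed_radix_set : closed D.
Proof.
have Dcl : D `<=` \bigcup_(d in A)
    ((fun z => p%:R * z - d%:~R) @^-1` closure D).
  by move=> z /radix_setP-/(_ p_gt1)[d Ad Dd]; exists d => //; exact: subset_closure.
have clcl : closed (\bigcup_(d in A)
    ((fun z : R => p%:R * z - d%:~R) @^-1` closure D)).
  apply: closed_bigcup; first exact: finite_digits.
  move=> d _; apply: preimage_closed; last exact: closed_closure.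
  by move=> z _; exact: continuous_strip.
apply: (radix_set_coind p_gt1 (c := 1)) => z.
  move=> clz; rewrite ler_norml; apply/andP; split.
    apply: (@closed_ge R (-1)); apply: closure_subset clz.
    by move=> y /radix_set_range/andP[].
  apply: (@closed_le R 1); apply: closure_subset clz.
  by move=> y /radix_set_range/andP[].
move=> clz; have [d Ad cld] := clcl _ (closure_subset Dcl clz).
by exists d.
Qed.

(** The integers [k] for which [(k + D) / p ^ n] is a cell of level [n]. *)
Fixpoint level_digits n : set int :=
  if n is m.+1 then [set p%:Z * k + d | k in level_digits m & d in A]
  else [set 0].

Lemma finite_level_digits n : finite_set (level_digits n).
Proof.
by elim: n => [|n IH]; [exact: finite_set1
                       | exact: finite_image2 IH finite_digits].
Qed.

Lemma level_cellsP n z :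
  D z <-> exists2 k, level_digits n k & D (p%:R ^+ n * z - k%:~R).
Proof.
elim: n => [|n IH] /=.
  split=> [Dz|[_ -> ]]; last by rewrite expr0 mul1r subr0.
  by exists 0 => //; rewrite expr0 mul1r subr0.
have stripE (k d : int) : p%:R * (p%:R ^+ n * z - k%:~R) - d%:~R =
    p%:R ^+ n.+1 * z - (p%:Z * k + d)%:~R.
  by rewrite rmorphD rmorphM/= pZ exprS; ring.
rewrite IH; split=> [[k nk /(radix_setP p_gt1)[d Ad Dd]]|[_ [k nk [d Ad <-]] Dd]].
  by exists (p%:Z * k + d); [exists k => //; exists d | rewrite -stripE].
by exists k => //; apply/(radix_setP p_gt1); exists d; rewrite ?stripE.
Qed.

(** Only finitely many cells of a given level exist and they are closed, so
    the cells avoiding [x] stay away from it. *)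
Lemma near_level_cells n x : exists2 e, 0 < e & forall y, D y -> `|y - x| < e ->
  exists2 k, level_digits n k &
    D (p%:R ^+ n * x - k%:~R) /\ D (p%:R ^+ n * y - k%:~R).
Proof.
pose E := \bigcup_(k in level_digits n `&`
    [set k | ~ D (p%:R ^+ n * x - k%:~R)])
  ((fun z => p%:R ^+ n * z - k%:~R) @^-1` D).
have cE : closed E.
  apply: closed_bigcup; first exact/finite_setIl/finite_level_digits.
  move=> k _; apply: preimage_closed; last exact: closed_radix_set.
  by move=> z _; exact: continuous_strip.
have nEx : ~ E x by move=> [k [_ nDx] /nDx].
have [e e0 eE] := closed_hole cE nEx.
exists e => // y /(level_cellsP n)[k nk Dk] yx; exists k => //; split=> //.
by apply: contrapT => nDx; apply: (eE _ yx); exists k.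
Qed.

(** The cells containing [x] shrink to [x]; since their sizes are known, the
    bound holds for the whole convex hull of the cell. *)
Lemma small_level_cell x e : D x -> 0 < e -> exists n k,
  level_digits n k /\
  forall y, -1 <= y <= 1 -> `|(k%:~R + y) / p%:R ^+ n - x| < e.
Proof.
move=> Dx e0; have [n ne] := expn_archimedean 2 e0.
have [k nk /radix_set_range kx] := (level_cellsP n x).1 Dx.
exists n, k; split=> // y y1.
rewrite -(ltr_pM2r (pn_gt0 n)) -{2}(gtr0_norm (pn_gt0 n)) -normrM mulrBl.
rewrite divfK ?gt_eqF// [e * _]mulrC; apply: le_lt_trans ne.
by rewrite ler_norml; lra.
Qed.

Lemma level_cell_sub n k y :
  level_digits n k -> D y -> D ((k%:~R + y) / p%:R ^+ n).
Proof.
move=> nk Dy; apply/(level_cellsP n); exists k => //.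
by rewrite mulrC divfK ?gt_eqF// addrAC subrr add0r.
Qed.

Lemma perfect_radix_set : perfect_set D.
Proof.
split; first exact: closed_radix_set.
apply/seteqP; split=> x.
  move=> lx; apply: closed_radix_set => U Ux.
  by have [y [_ Dy Uy]] := lx U Ux; exists y.
move=> Dx U /nbhs_ballP[e /= e0 eU].
have [n [k [nk kx]]] := small_level_cell Dx e0.
have in_U y : -1 <= y <= 1 -> U ((k%:~R + y) / p%:R ^+ n).
  by move=> /kx yx; apply: eU; rewrite /ball/= distrC.
have [eqx|neqx] := eqVneq ((k%:~R + 1) / p%:R ^+ n) x; last first.
  by exists ((k%:~R + 1) / p%:R ^+ n); split=> //;
    [exact/level_cell_sub/radix_set_max | apply: in_U; lra].
exists ((k%:~R + (-1)) / p%:R ^+ n); split=> //; last by apply: in_U; lra.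
  rewrite -eqx; apply/negP => /eqP /(divIf (lt0r_neq0 (pn_gt0 n))) ?; lra.
exact/level_cell_sub/radix_set_min.
Qed.

Lemma interval_near (u0 v0 : R) : u0 < v0 ->
  (forall y, u0 <= y <= v0 -> D y) -> forall x e, D x -> 0 < e ->
  exists u v, [/\ x - e < u, u < v, v < x + e &
                  forall y, u <= y <= v -> D y].
Proof.
move=> uv0 uvD x e Dx e0; have [n [k [nk kx]]] := small_level_cell Dx e0.
have := kx u0 (radix_set_range (uvD u0 _)).
have := kx v0 (radix_set_range (uvD v0 _)).
rewrite !ltr_norml !lexx !(ltW uv0)/= => /(_ isT) kv /(_ isT) ku.
exists ((k%:~R + u0) / p%:R ^+ n), ((k%:~R + v0) / p%:R ^+ n); split.
- lra.
- by rewrite ltr_pM2r ?invr_gt0//; lra.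
- lra.
move=> y; rewrite ler_pdivrMr// ler_pdivlMr// => y_uv.
apply/(level_cellsP n); exists k => //; apply: uvD; lra.
Qed.

(** Multiplying by [p ^ n] and dropping [n] digits turns a piece of [D] into
    all of [D] modulo the integers; when the piece contains an interval of
    length [p ^- n] every real is reached. *)
Lemma interval_translates (u v : R) : u < v ->
  (forall y, u <= y <= v -> D y) -> forall w, exists j : int, D (w + j%:~R).
Proof.
move=> uv uvD w; have [|n nuv] := @expn_archimedean 1 (v - u); first lra.
pose m := Num.floor (p%:R ^+ n * v - w).
have m_le : m%:~R <= p%:R ^+ n * v - w := floor_le _.
have m_gt : p%:R ^+ n * v - w < m%:~R + 1.
  by have := floorD1_gt (p%:R ^+ n * v - w); rewrite rmorphD/=.
have /(level_cellsP n)[k _] : D ((w + m%:~R) / p%:R ^+ n).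
  by apply: uvD; rewrite ler_pdivlMr// ler_pdivrMr//; lra.
rewrite mulrC divfK ?gt_eqF// => Dk; exists (m - k).
by rewrite rmorphB/= addrA.
Qed.

Lemma level_residues : (forall m : int, exists2 d, A d & (p%:Z %| m - d)%Z) ->
  forall n (m : int), exists2 k, level_digits n k &
    exists q : int, m = k + q * (p%:Z ^+ n).
Proof.
move=> res; elim=> [|n IH] m; first by exists 0 => //; exists m; rewrite expr0; lia.
have [d Ad /dvdzP[m' m'E]] := res m.
have [k nk [q qE]] := IH m'.
exists (p%:Z * k + d); first by exists k => //; exists d.
exists q; rewrite exprS -[LHS](subrK d) m'E qE; ring.
Qed.

(** With a complete residue system of digits every real is within [p ^- n] of an
    integer translate of [D], for all [n]. Finitely many closed translates then
    cover [0, 1], so one of them, hence [D], contains an interval. *)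
Lemma residues_interval : (forall m : int, exists2 d, A d & (p%:Z %| m - d)%Z) ->
  exists u v : R, u < v /\ forall y, u <= y <= v -> D y.
Proof.
move=> /level_residues res.
(* [D] being in [-1, 1], only these translates reach [0, 2], where the points
   found just above [w] lie *)
pose s : seq int := [:: -1; 0; 1; 2; 3].
apply: (@closed_translates_interval R D s closed_radix_set 0 1) => // w w01.
apply: contrapT => nDw.
pose E := \bigcup_(j in [set` s]) ((fun z : R => 1 * z - j%:~R) @^-1` D).
have cE : closed E.
  apply: closed_bigcup; first exact: finite_seq.
  move=> k _; apply: preimage_closed; last exact: closed_radix_set.
  by move=> z _; exact: continuous_strip.
have nEw : ~ E w.
  by move=> [j js /= Dj]; apply: nDw; exists j => //; rewrite -[w]mul1r.
have [e e0 eE] := closed_hole cE nEw.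
have [n ne] := expn_archimedean 3 e0.
have [k nk [q qE]] := res n (Num.floor (p%:R ^+ n * w)).
have m_le : (Num.floor (p%:R ^+ n * w))%:~R <= p%:R ^+ n * w :=
  floor_le _.
have m_gt : p%:R ^+ n * w < (Num.floor (p%:R ^+ n * w))%:~R + 1.
  by have := floorD1_gt (p%:R ^+ n * w); rewrite rmorphD/=.
move: m_le m_gt; rewrite qE rmorphD rmorphM rmorphXn/= pZ => m_le m_gt.
have Dy := level_cell_sub nk radix_set_max.
set y := (_ / _) in Dy.
have yE : k%:~R + 1 = y * p%:R ^+ n by rewrite divfK ?gt_eqF.
have pn1 : 1 <= p%:R ^+ n :> R by rewrite exprn_ege1// ler1n; lia.
have yqw : w <= y + q%:~R.
  by rewrite -(ler_pM2r (pn_gt0 n)); nra.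
have ywq1 : (y + q%:~R - w) * p%:R ^+ n <= 1 by nra.
have ywq : y + q%:~R - w <= 1.
  by rewrite -(ler_pM2r (pn_gt0 n)); nra.
have ywqe : y + q%:~R - w < e.
  by rewrite -(ltr_pM2r (pn_gt0 n)); nra.
apply: (eE (y + q%:~R)); first by rewrite ltr_norml; lra.
exists q; last by rewrite /= mul1r addrK.
have := radix_set_range Dy => y1.
have q4 : -2 < q < 4.
  by rewrite -!(ltr_int R) rmorphN/= -[4%:~R]/(4%:R) -[2%:~R]/(2%:R); lra.
by rewrite /= !inE; clear -q4; lia.
Qed.

(** Only the cell of the largest digit reaches beyond [1 - p^-1], so near its
    maximum [D] is its own image under the contraction towards 1. *)
Lemma radix_set_zoom_max n z : 0 < z <= 1 ->
  D (1 - (1 - z) / p%:R ^+ n) <-> D z.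
Proof.
move=> z01; elim: n => [|n <-].
  by rewrite expr0 divr1; have -> : 1 - (1 - z) = z by ring.
set t := (1 - z) / p%:R ^+ n.
have t01 : 0 <= t < 1.
  rewrite ler_pdivlMr// ltr_pdivrMr// mul1r mul0r.
  have : 1 <= p%:R ^+ n :> R by rewrite exprn_ege1// ler1n; lia.
  lra.
have -> : (1 - z) / p%:R ^+ n.+1 = t / p%:R.
  by rewrite exprSr invfM mulrA.
have stripE : p%:R * (1 - t / p%:R) - (p%:Z - 1)%:~R = 1 - t.
  by rewrite rmorphB/= pZ; field; rewrite gt_eqF.
split=> [/(radix_setP p_gt1)[d Ad Dd]|Dt].
  suff dE : d = p%:Z - 1 by move: Dd; rewrite dE stripE.
  suff : p%:Z - 2 < d by have := A_le Ad; clear; lia.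
  rewrite -(ltr_int R) rmorphB/= pZ -[2%:~R]/(2%:R).
  move: Dd => /radix_set_range; rewrite mulrBr mulr1 mulrCA divff ?gt_eqF//.
  lra.
by apply/(radix_setP p_gt1); exists (p%:Z - 1) => //; rewrite stripE.
Qed.

(** Blown up by a factor making the adjacent hole longer than [D], the left
    endpoint [x] of a gap can only be the maximum of each cell it lies in:
    the maximum of that cell would otherwise fall into the hole. *)
Lemma gap_left_cell x g : 0 < g -> (forall y, x < y < x + g -> ~ D y) ->
  exists n, forall k, level_digits n k -> D (p%:R ^+ n * x - k%:~R) ->
  p%:R ^+ n * x - k%:~R = 1.
Proof.
move=> g0 hole; have [n ng] := expn_archimedean 2 g0; exists n => k nk.
move=> /radix_set_range x1; apply: contrapT => /eqP x_neq1.
have x_lt1 : p%:R ^+ n * x - k%:~R < 1.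
  by rewrite lt_neqAle x_neq1; case/andP: x1.
case: (hole _ _ (level_cell_sub nk radix_set_max)).
rewrite ltr_pdivlMr// ltr_pdivrMr//; lra.
Qed.

Lemma gap_left_interval x g : D x -> 0 < g ->
  (forall y, x < y < x + g -> ~ D y) -> (forall z, 0 <= z <= 1 -> D z) ->
  exists2 e, 0 < e & forall y, x - e <= y <= x -> D y.
Proof.
move=> Dx g0 /(gap_left_cell g0)[n ncell] D01.
have [k nk Dk] := (level_cellsP n x).1 Dx; have xk := ncell k nk Dk.
exists (p%:R ^- n); first by rewrite invr_gt0.
move=> y /andP[y_ge y_le]; apply/(level_cellsP n); exists k => //; apply: D01.
have : p%:R ^+ n * (x - p%:R ^- n) <= p%:R ^+ n * y by rewrite ler_pM2l.
have : p%:R ^+ n * y <= p%:R ^+ n * x by rewrite ler_pM2l.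
rewrite mulrBr divff ?gt_eqF//; lra.
Qed.

(** Near the left endpoint of a gap the set looks as it does near its maximum,
    which by zooming looks like all of its positive part. *)
Lemma gap_left_holes x g : 0 < g ->
  (forall y, x < y < x + g -> ~ D y) -> ~ (forall z, 0 < z <= 1 -> D z) ->
  forall e, 0 < e -> exists2 y, x - e < y < x & ~ D y.
Proof.
move=> g0 /(gap_left_cell g0)[n ncell] nD01 e e0; apply: contrapT => no_hole.
apply: nD01 => z z01; have [d d0 near_x] := near_level_cells n x.
have [m] : exists m, 1 < p%:R ^+ m * (p%:R ^+ n * Num.min d e).
  by apply: expn_archimedean; rewrite mulr_gt0// lt_min d0.
rewrite mulrCA -ltr_pdivrMl//= mulr1 => m_small.
have pm0 := pn_gt0 m; have pn0 := pn_gt0 n.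
have [z1|z_neq1] := eqVneq z 1; first by rewrite z1; exact: radix_set_max.
pose t := (1 - z) / p%:R ^+ m.
have t0 : 0 < t by rewrite divr_gt0// subr_gt0 lt_neqAle z_neq1; lra.
have tx : t / p%:R ^+ n < Num.min d e.
  rewrite -(ltr_pM2l pm0); apply: le_lt_trans m_small.
  rewrite mulrA mulrCA divff ?gt_eqF// mulr1 ler_piMl ?invr_ge0 ?ltW//; lra.
have tn0 : 0 < t / p%:R ^+ n by rewrite divr_gt0.
move: tx; rewrite lt_min => /andP[td te].
have Dy : D (x - t / p%:R ^+ n).
  by apply: contrapT => nDy; apply: no_hole; eexists; last exact: nDy; lra.
have [|k nk [/(ncell k nk) xk]] := near_x _ Dy.
  by rewrite ltr_norml; lra.
rewrite mulrBr mulrCA divff ?gt_eqF// mulr1 addrAC xk.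
by move/(radix_set_zoom_max m z01).
Qed.

End SelfSimilar.

(** * Gaps and components of subsets of the line *)

Section LineTopology.
Variable R : realType.
Implicit Types (E K G : set R) (F : set (set R)) (a x y z : R).

Lemma connected_componentP E x y : connected_component E x y <->
  forall t, Num.min x y <= t <= Num.max x y -> E t.
Proof.
split=> [[C [Cx CE /connected_intervalP Ci] Cy] t|E_xy].
  rewrite ge_min le_max => t_xy; apply: CE.
  have [xy|yx] := leP x y; first by apply: (Ci x y) => //; lra.
  by apply: (Ci y x) => //; lra.
exists `[Num.min x y, Num.max x y]%classic.
  split; last exact: segment_connected.
    by rewrite /= in_itv/= ge_min le_max !lexx.
  by move=> t /=; rewrite in_itv => /E_xy.
by rewrite /= in_itv/= ge_min le_max !lexx !orbT.
Qed.

Lemma component_mem E x y : connected_component E x y -> E y.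
Proof. exact: connected_component_sub. Qed.

Lemma component_lt E x y z : ~ E z -> x < z -> connected_component E x y -> y < z.
Proof.
move=> nEz xz /connected_componentP Exy; rewrite ltNge; apply/negP => zy.
by apply: nEz; apply: Exy; rewrite ge_min le_max zy (ltW xz) orbT.
Qed.

Lemma component_gt E x y z : ~ E z -> z < x -> connected_component E x y -> z < y.
Proof.
move=> nEz xz /connected_componentP Exy; rewrite ltNge; apply/negP => zy.
by apply: nEz; apply: Exy; rewrite ge_min le_max zy (ltW xz) orbT.
Qed.

Lemma component_itv E x y :
  x <= y -> (forall t, x <= t <= y -> E t) -> connected_component E x y.
Proof.
by move=> xy Exy; apply/connected_componentP; rewrite (min_idPl xy) (max_idPr xy).
Qed.

Lemma gap_left_endpointP E G a : closed E -> gaps E G -> left_endpoint G a ->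
  E a /\ exists2 g, 0 < g & forall y, a < y < a + g -> ~ E y.
Proof.
move=> cE [y0 nEy0 <-] [hasG ->]; set G0 := connected_component _ _ in hasG *.
have G0_ge t : G0 t -> inf G0 <= t by apply: ge_inf; case: hasG.
have G0y0 : G0 y0 by apply: component_itv => // t; rewrite -eq_le => /eqP <-.
have G0_above t : inf G0 < t -> t <= y0 -> ~ E t.
  move=> lt_t ty0; have [|t' G0t'] := @inf_adherent _ G0 (t - inf G0) _ hasG.
    by rewrite subr_gt0.
  rewrite addrC subrK => t't; case: (connected_componentP (~` E) y0 t') => + _.
  by apply=> //; rewrite ge_min le_max ty0 (ltW t't) !orbT.
have Einf : E (inf G0).
  apply: contrapT => /(closed_hole cE)[e e0 eE].
  suff /G0_ge : G0 (inf G0 - e / 2) by lra.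
  apply/connected_componentP => t.
  rewrite ge_min le_max => t_in.
  have [lt_t|t_le] := ltP (inf G0) t.
    apply: G0_above => //; have := G0_ge _ G0y0; lra.
  by apply: eE; rewrite ltr_norml; have := G0_ge _ G0y0; lra.
split=> //; exists (y0 - inf G0); last by move=> y ?; apply: G0_above; lra.
rewrite subr_gt0 lt_neqAle G0_ge// andbT; apply/eqP => eq_y0.
by apply: nEy0; rewrite -eq_y0.
Qed.

Lemma left_of_not_closure K a (c : R) :
  (forall z, K z -> z <= c) -> c < a -> ~ closure K a.
Proof.
move=> Kc ca /(closure_subset Kc)/(@closed_le R c)/=; rewrite leNgt ca//.
Qed.

(** A finite family of sets whose closures avoid [a] misses a neighbourhood of
    [a], so finding one such set in every neighbourhood gives infinitely many. *)
Lemma clusters_atI F a :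
  (forall e, 0 < e -> exists K, [/\ F K, K !=set0,
     forall y, K y -> `|y - a| < e & ~ closure K a]) ->
  clusters_at F a.
Proof.
move=> FK U /nbhs_ballP[e /= e0 eU] finU.
pose S := [set K | F K /\ K `<=` U] `&` [set K | ~ closure K a].
have cS : closed (\bigcup_(K in S) closure K).
  apply: closed_bigcup; first exact: finite_setIl.
  by move=> K _; exact: closed_closure.
have [|d d0 dS] := closed_hole (x := a) cS; first by case=> K [_ nKa] /nKa.
have [|K [FKK [y Ky] Kde nKa]] := FK (Num.min d e); first by rewrite lt_min d0.
apply: (dS y).
  by have := Kde y Ky; rewrite lt_min => /andP[].
exists K; last exact: subset_closure.
split=> //; split=> // z /Kde; rewrite lt_min => /andP[_ ze].
by apply: eU; rewrite /ball/= distrC.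
Qed.

(** Holes of [E] approach [a] from the left, and so do intervals of [E], because
    an interval near [a] cannot enter the hole on the right. Two holes trap a
    component between them, and two intervals trap a gap. *)
Lemma left_end_clusters E a (g : R) : 0 < g ->
  (forall y, a < y < a + g -> ~ E y) ->
  (forall e : R, 0 < e -> exists2 y, a - e < y < a & ~ E y) ->
  (forall e : R, 0 < e -> exists u v, [/\ a - e < u, u < v, v < a + e &
                                    forall y, u <= y <= v -> E y]) ->
  gaps_and_components_cluster_at E a.
Proof.
move=> g0 hole holes ivals.
have ivals_left (e : R) : 0 < e -> exists u v,
    [/\ a - e < u, u < v, v < a & forall y, u <= y <= v -> E y].
  move=> e0; have [|u [v [eu uv ve uvE]]] := ivals (Num.min e g).
    by rewrite lt_min e0.
  have : Num.min e g <= e by rewrite ge_min lexx.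
  have : Num.min e g <= g by rewrite ge_min lexx orbT.
  (* otherwise [v] would lie both in [E] and in the hole *)
  have va : v <= a.
    rewrite leNgt; apply/negP => av; apply: (hole v); last by apply: uvE; lra.
    by have : Num.min e g <= g; [rewrite ge_min lexx orbT | lra].
  move=> ? ?; exists u, ((u + v) / 2); split; try lra.
  by move=> y ?; apply: uvE; lra.
split; apply: clusters_atI => e e0.
  have [u1 [v1 [eu1 uv1 v1a uvE1]]] := ivals_left _ e0.
  have [|y ya nEy] := holes (a - v1); first lra.
  have [|u2 [v2 [eu2 uv2 v2a uvE2]]] := ivals_left (a - y); first lra.
  have Gv1 z : connected_component (~` E) y z -> v1 < z.
    by apply: component_gt => [nE|]; [apply/nE/uvE1; lra | lra].
  have Gu2 z : connected_component (~` E) y z -> z < u2.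
    by apply: component_lt => [nE|]; [apply/nE/uvE2; lra | lra].
  exists (connected_component (~` E) y); split.
  - by exists y.
  - by exists y; apply: component_itv => // t; rewrite -eq_le => /eqP <-.
  - by move=> z Gz; rewrite ltr_norml; have := Gv1 z Gz; have := Gu2 z Gz; lra.
  - by apply: (@left_of_not_closure _ _ u2) => [z /Gu2/ltW//|]; lra.
have [y ya nEy] := holes _ e0.
have [|u [v [eu uv va uvE]]] := ivals_left (a - y); first lra.
have [|y' ya' nEy'] := holes (a - v); first lra.
have Ky z : connected_component E u z -> y < z.
  by apply: component_gt => //; lra.
have Ky' z : connected_component E u z -> z < y'.
  by apply: component_lt => //; lra.
have Ku : connected_component E u u.
  by apply: component_itv => // t ?; apply: uvE; lra.
exists (connected_component E u); split.
- split; first by exists u => //; apply: uvE; lra.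
  case=> x Kx; have : u = x by move: Ku; rewrite Kx.
  have : v = x.
    by suff : connected_component E u v; [rewrite Kx | exact/component_itv/uvE/ltW].
  lra.
- by exists u.
- by move=> z Kz; rewrite ltr_norml; have := Ky z Kz; have := Ky' z Kz; lra.
- by apply: (@left_of_not_closure _ _ y') => [z /Ky'/ltW//|]; lra.
Qed.

Lemma left_end_proper E a (g e : R) : 0 < g ->
  (forall y, a < y < a + g -> ~ E y) ->
  0 < e -> (forall y, a - e <= y <= a -> E y) -> ends_proper_component E a.
Proof.
move=> g0 hole e0 eE.
have Ka : connected_component E a a.
  by apply: component_itv => // t; rewrite -eq_le => /eqP <-; apply: eE; lra.
have Kub z : connected_component E a z -> z <= a.
  move=> /connected_componentP Eaz; rewrite leNgt; apply/negP => az.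
  rewrite (min_idPl (ltW az)) (max_idPr (ltW az)) in Eaz.
  have [z_le|z_gt] := leP z (a + g / 2).
    by apply: (hole z); [lra | apply: Eaz; lra].
  by apply: (hole (a + g / 2)); [lra | apply: Eaz; lra].
exists (connected_component E a).
  split; first by exists a => //; apply: eE; lra.
  case=> x Kx; have : a = x by move: Ka; rewrite Kx.
  suff : a - e = x by lra.
  suff : connected_component E a (a - e) by rewrite Kx.
  by apply/connected_componentP => t; rewrite ge_min le_max => t_in; apply: eE; lra.
have hs : has_sup (connected_component E a) by split; exists a.
right; split=> //; apply/eqP; rewrite eq_le; apply/andP; split.
  by apply: ub_le_sup => //; case: hs.
by apply: ge_sup => //; case: hs.
Qed.

(** At its maximum a set cannot both end a nondegenerate component and be
    accumulated by gaps: the only gap nearby is the unbounded one. *)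
Lemma max_not_proper_and_clusters E (m : R) : E m -> (forall y, E y -> y <= m) ->
  ends_proper_component E m -> ~ clusters_at (gaps E) m.
Proof.
move=> Em Em_ub [_ [[x Ex <-] /= nsing] endK].
set K := connected_component E x in nsing endK.
have KE z : K z -> E z by exact: component_mem.
have [u Ku um] : exists2 u, K u & u < m.
  apply: contrapT => nu; apply: nsing; exists m; apply/seteqP; split=> [z Kz|_ ->].
    apply/eqP; rewrite eq_le (Em_ub z (KE z Kz)) leNgt; apply/negP => zm.
    by apply: nu; exists z.
  have Kx : K x by apply: component_itv => // t; rewrite -eq_le => /eqP <-.
  suff <- : x = m by [].
  apply/eqP; rewrite eq_le Em_ub//= leNgt; apply/negP => xm.
  by apply: nu; exists x.
have [|m_sup] := endK.
  by move=> [[_ lbK] minf]; have := ge_inf lbK Ku; rewrite -minf leNgt um.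
have umE t : u <= t <= m -> E t.
  move=> /andP[ut tm]; have [->//|t_neq] := eqVneq t m.
  have tm' : t < m by rewrite lt_neqAle t_neq.
  have [|t' Kt'] := @sup_adherent _ K (m - t) _ m_sup.1; first by rewrite subr_gt0.
  rewrite -m_sup.2 subKr => tt'.
  have : connected_component E u t'.
    by rewrite /K in Ku Kt' *; rewrite -(same_connected_component Ku).
  by move=> /connected_componentP; apply; rewrite ge_min le_max ut (ltW tt') orbT.
move=> /(_ (ball m (m - u))); case; first by apply: nbhsx_ballx; rewrite subr_gt0.
suff -> : [set G | gaps E G /\ G `<=` ball m (m - u)] = set0 by exact: finite_set0.
rewrite -subset0 => _ [[y nEy <-] sub_ball].
have Gy : connected_component (~` E) y y.
  by apply: component_itv => // t; rewrite -eq_le => /eqP <-.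
have my : m < y.
  rewrite ltNge; apply/negP => ym; apply: nEy; apply: umE; rewrite ym andbT.
  by have := sub_ball _ Gy; rewrite /ball/= ltr_norml; lra.
have : connected_component (~` E) y (y + (m - u)).
  by apply: component_itv => [|t ty /Em_ub]; lra.
by move=> /sub_ball; rewrite /ball/= ltr_norml; lra.
Qed.

Lemma max_left_endpoint E (m : R) : E m -> (forall y, E y -> y <= m) ->
  exists2 G, gaps E G & left_endpoint G m.
Proof.
move=> Em Em_ub; have nEm1 : ~ E (m + 1) by move=> /Em_ub; lra.
have G_gt z : connected_component (~` E) (m + 1) z -> m < z.
  by apply: component_gt => [/(_ Em)|]; [|lra].
have hasG : has_inf (connected_component (~` E) (m + 1)).
  split; first by exists (m + 1); apply: component_itv => // t;
    rewrite -eq_le => /eqP <-.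
  by exists m => z /G_gt/ltW.
exists (connected_component (~` E) (m + 1)); first by exists (m + 1).
split=> //; apply/eqP; rewrite eq_le; apply/andP; split.
  by apply: lb_le_inf; [case: hasG | move=> z /G_gt/ltW].
apply/ler_addgt0Pr => e e0.
apply: (@le_trans _ _ (m + Num.min e 1)); last by rewrite lerD2l ge_min lexx.
apply: ge_inf; first by case: hasG.
apply/connected_componentP => t; rewrite ge_min le_max.
have : 0 < Num.min e 1 by rewrite lt_min e0 ltr01.
by move=> ? t_in /Em_ub; lra.
Qed.

End LineTopology.

(** * Reflection *)

Section Reflection.
Variable R : realType.
Implicit Types (E K G U : set R) (F : set (set R)) (a x y : R).

(** Reflection exchanges left and right endpoints of gaps, and swapping the two
    Cantor sets reflects their difference; it halves the work on endpoints. *)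
Definition mirror E : set R := [set x | E (- x)].

Lemma mirrorK : involutive mirror.
Proof. by move=> E; apply/funext => x; rewrite /mirror/= opprK. Qed.

Lemma component_mirror E x :
  connected_component (mirror E) x = mirror (connected_component E (- x)).
Proof.
have half E' x' y : connected_component E' (- x') (- y) ->
    connected_component (mirror E') x' y.
  move=> /connected_componentP Exy; apply/connected_componentP => t t_xy.
  apply: Exy; move: t_xy; rewrite !ge_min !le_max; lra.
apply/seteqP; split=> y; last exact: half.
by have := half (mirror E) (- x) (- y); rewrite mirrorK !opprK; apply.
Qed.

Lemma components_mirror E : components (mirror E) = mirror @` components E.
Proof.
have half E' : components (mirror E') `<=` mirror @` components E'.
  move=> _ [x Ex <-]; exists (connected_component E' (- x)); first by exists (- x).
  by rewrite component_mirror.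
apply/seteqP; split; first exact: half.
move=> _ [K EK <-]; have := @half (mirror E) K; rewrite mirrorK.
by move=> /(_ EK)[K' EK' <-]; rewrite mirrorK.
Qed.

Lemma gaps_mirror E : gaps (mirror E) = mirror @` gaps E.
Proof. exact: (components_mirror (~` E)). Qed.

Lemma proper_components_mirror E :
  proper_components (mirror E) = mirror @` proper_components E.
Proof.
have half E' : proper_components (mirror E') `<=` mirror @` proper_components E'.
  move=> K []; rewrite components_mirror => -[K' EK' <-] nsing.
  exists K' => //; split=> // -[x K'x]; apply: nsing; exists (- x).
  rewrite K'x; apply/seteqP; split=> y; rewrite /mirror/=.
    by move=> <-; rewrite opprK.
  by move=> ->; rewrite opprK.
apply/seteqP; split; first exact: half.
move=> _ [K EK <-]; have := @half (mirror E) K; rewrite mirrorK.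
by move=> /(_ EK)[K' EK' <-]; rewrite mirrorK.
Qed.

Lemma opp_image_mirror K : -%R @` K = mirror K.
Proof.
apply/seteqP; split=> [_ [x Kx <-]|x Kx]; first by rewrite /mirror/= opprK.
by exists (- x); rewrite ?opprK.
Qed.

Lemma left_endpoint_mirror K a :
  left_endpoint (mirror K) a <-> right_endpoint K (- a).
Proof.
rewrite /left_endpoint /right_endpoint -has_inf_supN /inf opp_image_mirror mirrorK.
by split=> -[? eq_a]; split=> //; rewrite -?eq_a ?opprK// eq_a opprK.
Qed.

Lemma right_endpoint_mirror K a :
  right_endpoint (mirror K) a <-> left_endpoint K (- a).
Proof. by rewrite -{2}[K]mirrorK left_endpoint_mirror opprK. Qed.

Lemma clusters_at_mirror F a :
  clusters_at (mirror @` F) a -> clusters_at F (- a).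
Proof.
move=> Fa U Ua finU; apply: (Fa (mirror U)).
  by have : -%R x @[x --> a] --> - a; [exact: cvgN | exact].
apply: sub_finite_set (finite_image mirror finU).
move=> _ [[K FK <-] KU]; exists K => //; split=> // x Kx.
by rewrite -[x]opprK; apply: KU; rewrite /mirror/= opprK.
Qed.

Lemma cluster_at_mirror E a :
  gaps_and_components_cluster_at (mirror E) a ->
  gaps_and_components_cluster_at E (- a).
Proof.
rewrite /gaps_and_components_cluster_at gaps_mirror proper_components_mirror.
by move=> [? ?]; split; exact: clusters_at_mirror.
Qed.

Lemma ends_proper_mirror E a :
  ends_proper_component (mirror E) a -> ends_proper_component E (- a).
Proof.
move=> [K]; rewrite proper_components_mirror => -[K' EK' <-] Ka.
exists K' => //; case: Ka => [/left_endpoint_mirror|/right_endpoint_mirror] ?.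
  by right.
by left.
Qed.

Lemma right_end_gap_mirror E G a : gaps E G -> right_endpoint G a ->
  gaps (mirror E) (mirror G) /\ left_endpoint (mirror G) (- a).
Proof.
move=> EG Ga; split; first by rewrite gaps_mirror; exists G.
by apply/left_endpoint_mirror; rewrite opprK.
Qed.

End Reflection.

(** * Telling the types apart *)

Section CantorvalTypes.
Variables (R : realType) (E : set R).
Hypothesis E_range : forall y : R, E y -> -1 <= y <= 1.
Hypothesis E1 : E 1.
Hypothesis EN1 : E (-1).

Lemma gap_left_of_1 : exists2 G, gaps E G & left_endpoint G 1.
Proof. by apply: max_left_endpoint => // y /E_range/andP[]. Qed.

Lemma gap_right_of_N1 : exists2 G, gaps E G & right_endpoint G (-1).
Proof.
have [|G] := @max_left_endpoint _ (mirror E) 1 EN1.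
  by move=> y /E_range; lra.
rewrite gaps_mirror => -[G' EG' <-] /left_endpoint_mirror G'1.
by exists G'.
Qed.

Lemma proper_not_cluster_1 :
  ends_proper_component E 1 -> ~ gaps_and_components_cluster_at E 1.
Proof.
move=> e1 [c1 _]; apply: max_not_proper_and_clusters e1 c1 => //.
by move=> y /E_range/andP[].
Qed.

Lemma proper_not_cluster_N1 :
  ends_proper_component E (-1) -> ~ gaps_and_components_cluster_at E (-1).
Proof.
rewrite -[E]mirrorK => /ends_proper_mirror e1 /cluster_at_mirror[c1 _].
move: e1 c1; rewrite opprK; apply: max_not_proper_and_clusters => //.
by move=> y /E_range; lra.
Qed.

Lemma L_Cantorval_ends : is_L_Cantorval E ->
  gaps_and_components_cluster_at E 1 /\ ends_proper_component E (-1).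
Proof.
have [G EG G1] := gap_left_of_1; have [H EH HN1] := gap_right_of_N1.
by move=> [_ _ L1 L2]; split; [exact: L1 EG G1 | exact: L2 EH HN1].
Qed.

Lemma R_Cantorval_ends : is_R_Cantorval E ->
  gaps_and_components_cluster_at E (-1) /\ ends_proper_component E 1.
Proof.
have [G EG G1] := gap_left_of_1; have [H EH HN1] := gap_right_of_N1.
by move=> [_ _ L1 L2]; split; [exact: L1 EH HN1 | exact: L2 EG G1].
Qed.

Lemma M_Cantorval_ends : is_M_Cantorval E ->
  gaps_and_components_cluster_at E 1 /\ gaps_and_components_cluster_at E (-1).
Proof.
have [G EG G1] := gap_left_of_1; have [H EH HN1] := gap_right_of_N1.
move=> [_ _ M]; split; first by apply: M EG _; left.
by apply: M EH _; right.
Qed.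

Lemma itv_ends : E = [set x | -1 <= x <= 1] ->
  ends_proper_component E 1 /\ ends_proper_component E (-1).
Proof.
have E_gt y : 1 < y < 1 + 1 -> ~ E y by move=> y1 /E_range; lra.
move=> EE; split.
  apply: (left_end_proper (g := 1) (e := 1)) => // y y1.
  by rewrite EE /=; lra.
rewrite -[1]opprK opprK; apply: ends_proper_mirror.
apply: (left_end_proper (g := 1) (e := 1)) => // y y1.
  by move=> /E_range; lra.
by rewrite EE /mirror/=; lra.
Qed.

Lemma Cantor_not_proper : is_Cantor_set E -> proper_components E = set0.
Proof.
move=> [_ _ [cE _] ndE]; rewrite -subset0 => K [[x Ex <-] nsing].
have noitv u v : u < v -> (forall y, u <= y <= v -> E y) -> False.
  move=> uv uvE; move: ndE; rewrite /nowhere_dense -(closure_id _).1//.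
  rewrite -subset0 => /(_ ((u + v) / 2)); apply; apply/nbhs_ballP.
  exists ((v - u) / 2) => /= [|y]; first lra.
  by rewrite /ball/= ltr_norml => ?; apply: uvE; lra.
apply: nsing; exists x; apply/seteqP; split=> y; last first.
  by move=> ->; apply: component_itv => // t; rewrite -eq_le => /eqP <-.
move=> /connected_componentP Exy; apply: contrapT => /eqP.
case: ltgtP Exy => // [yx|xy] Exy _; first exact: noitv yx Exy.
exact: noitv xy Exy.
Qed.

Lemma Cantor_ends : is_Cantor_set E -> forall a,
  ~ gaps_and_components_cluster_at E a /\ ~ ends_proper_component E a.
Proof.
move=> /Cantor_not_proper E0 a; split; last by move=> [K]; rewrite E0.
move=> [_ /(_ setT filterT)]; rewrite E0; apply.
by apply: (sub_finite_set (B := set0)); [move=> K [] | exact: finite_set0].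
Qed.

End CantorvalTypes.

(** * The three blocks of difference digits *)

Definition diff_digits (l1 r1 l2 r2 p : nat) : set int :=
  [set c - d | c in digits l1 r1 p & d in digits l2 r2 p].

Section DiffDigits.
Variables (R : realType) (l1 r1 l2 r2 p : nat).
Hypotheses (l1_gt0 : (0 < l1)%N) (r1_gt0 : (0 < r1)%N).
Hypotheses (l2_gt0 : (0 < l2)%N) (r2_gt0 : (0 < r2)%N) (p_gt2 : (2 < p)%N).
Hypotheses (lr1_lt_p : (l1 + r1 < p)%N) (lr2_lt_p : (l2 + r2 < p)%N).

Local Notation A := (diff_digits l1 r1 l2 r2 p).
Local Notation D := (radix_set A p : set R).

Lemma diff_digitsP (d : int) : A d <->
  [\/ 1 - p%:Z <= d <= l1%:Z + r2%:Z - 1 - p%:Z,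
      1 - l2%:Z <= d <= l1%:Z - 1,
      1 - r1%:Z <= d <= r2%:Z - 1 |
      p%:Z + 1 - r1%:Z - l2%:Z <= d <= p%:Z - 1].
Proof.
rewrite /diff_digits /digits /int_itv /=; split=> [[c cA [e eA <-]]|].
  move: cA eA => [/=c1|/=c1] [/=e1|/=e1];
    [apply: Or42|apply: Or41|apply: Or44|apply: Or43]; lia.
have split_diff (a b a' b' : int) : a <= b -> a' <= b' -> a - b' <= d <= b - a' ->
    exists c e : int, [/\ a <= c <= b, a' <= e <= b' & c - e = d].
  move=> ab ab' abd; have [a_le|a_gt] := leP a (d + a').
    by exists (d + a'), a'; split; lia.
  by exists a, (a - d); split; lia.
case=> [d_in|d_in|d_in|d_in].
- have [|||c [e [cA eA <-]]] := split_diff 0 (l1%:Z - 1) (p%:Z - r2%:Z) (p%:Z - 1);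
    try lia.
  by exists c; [left | exists e => //; right].
- have [|||c [e [cA eA <-]]] := split_diff 0 (l1%:Z - 1) 0 (l2%:Z - 1); try lia.
  by exists c; [left | exists e => //; left].
- have [|||c [e [cA eA <-]]] :=
    split_diff (p%:Z - r1%:Z) (p%:Z - 1) (p%:Z - r2%:Z) (p%:Z - 1); try lia.
  by exists c; [right | exists e => //; right].
- have [|||c [e [cA eA <-]]] :=
    split_diff (p%:Z - r1%:Z) (p%:Z - 1) 0 (l2%:Z - 1); try lia.
  by exists c; [right | exists e => //; left].
Qed.

Lemma diff_Cset : diff_set (Cset R l1 r1 p) (Cset R l2 r2 p) = D.
Proof.
have b l r : (l + r < p)%N -> forall d, digits l r p d -> `|d%:~R : R| <= p%:R.
  move=> lrp d dA; rewrite -[p%:R]/(p%:Z%:~R) -intr_norm ler_int.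
  by case: dA; rewrite /int_itv/= => ?; lia.
by apply: diff_radix_set; [lia | exact: b | exact: b].
Qed.

Let p_gt1 : (1 < p)%N. Proof. by lia. Qed.
Let p_gt0 : 0 < p%:R :> R. Proof. by rewrite ltr0n; lia. Qed.
Let pZ : p%:Z%:~R = p%:R :> R. Proof. by rewrite -pmulrn. Qed.
Let A_le : forall d, A d -> `|d| <= p%:Z - 1.
Proof. by move=> d /diff_digitsP[] ?; lia. Qed.
Let A_max : A (p%:Z - 1). Proof. by apply/diff_digitsP/Or44; lia. Qed.
Let A_min : A (1 - p%:Z). Proof. by apply/diff_digitsP/Or41; lia. Qed.
Let D_range := @radix_set_range R p A p_gt1 A_le.
Let D_closed := closed_radix_set p_gt1 A_le : closed D.
Let D_max := radix_set_max R p_gt1 A_max : D 1.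
Let D_min := radix_set_min R p_gt1 A_min : D (-1).

(** Stripping a digit further than 1 from [p z] leaves the range of [D]. *)
Lemma not_diff_radix (z : R) : (forall d, A d ->
    -1 <= p%:R * z - d%:~R <= 1 -> ~ D (p%:R * z - d%:~R)) -> ~ D z.
Proof.
move=> nD /(radix_setP p_gt1)[d Ad Dd]; exact: nD Ad (D_range Dd) Dd.
Qed.

(** The integers from 0 to [p - 1] are all digits, so ordinary base-[p]
    expansions are available. *)
Lemma S2star_nonneg : S2star l1 r1 l2 r2 p -> forall z, 0 <= z <= 1 -> D z.
Proof.
move=> s2; apply: (radix_set_coind p_gt1 (X := [set z | 0 <= z <= 1]) (c := 1)).
  by move=> z /= z01; rewrite ger0_norm; lra.
move=> z /= z01.
have Ad (d : int) : 0 <= d < p%:Z -> A d.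
  move=> dp; apply/diff_digitsP.
  have [?|?] := leP d (l1%:Z - 1); first by apply: Or42; lia.
  have [?|?] := leP d (r2%:Z - 1); first by apply: Or43; lia.
  by apply: Or44; case: s2; lia.
have [z1|z_neq1] := eqVneq z 1.
  by exists (p%:Z - 1); [apply: Ad; lia | rewrite z1 rmorphB/= pZ; lra].
have zp0 : 0 <= p%:R * z by rewrite mulr_ge0 ?(ltW p_gt0)//; lra.
have zpp : p%:R * z < p%:R.
  by rewrite gtr_pMr// lt_neqAle z_neq1; lra.
exists (Num.floor (p%:R * z)).
  apply: Ad; rewrite floor_ge0 zp0 /= -(ltr_int R).
  exact: le_lt_trans (floor_le _) zpp.
have := floor_le (p%:R * z); have := floorD1_gt (p%:R * z).
by rewrite rmorphD/=; lra.
Qed.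

Lemma S1_S2_cover : S1 l1 r1 l2 r2 p -> S2 l1 r1 l2 r2 p ->
  D = [set x | -1 <= x <= 1].
Proof.
move=> s1 s2; apply/seteqP; split=> [z /D_range//|].
apply: (radix_set_coind p_gt1 (c := 1)) => z /=; first by rewrite ler_norml.
move=> z1; have [z_max|z_neq1] := eqVneq z 1.
  by exists (p%:Z - 1) => //; rewrite z_max rmorphB/= pZ; lra.
pose m := Num.floor (p%:R * z).
have m_le : m%:~R <= p%:R * z := floor_le _.
have m_gt : p%:R * z < m%:~R + 1.
  by have := floorD1_gt (p%:R * z); rewrite rmorphD/=.
have zp_lt : p%:R * z < p%:R by rewrite gtr_pMr// lt_neqAle z_neq1; lra.
have zp_ge : - p%:R <= p%:R * z.
  by rewrite -[X in - X]mulr1 -mulrN ler_pM2l//; lra.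
have mp : - p%:Z <= m < p%:Z.
  apply/andP; split; last by rewrite -(ltr_int R); exact: le_lt_trans m_le zp_lt.
  by rewrite -ltzD1 -(ltr_int R) rmorphN rmorphD/= pZ; lra.
have [Am|Am1] : A m \/ A (m + 1).
  pose inA (d : int) := [|| 1 - p%:Z <= d <= l1%:Z + r2%:Z - 1 - p%:Z,
    1 - l2%:Z <= d <= l1%:Z - 1, 1 - r1%:Z <= d <= r2%:Z - 1 |
    p%:Z + 1 - r1%:Z - l2%:Z <= d <= p%:Z - 1].
  have : inA m || inA (m + 1) by rewrite /inA; move: s1 s2; rewrite /S1 /S2; lia.
  by case/orP => /or4P/diff_digitsP; [left | right].
- by exists m => //; lra.
- by exists (m + 1) => //; rewrite rmorphD/=; lra.
Qed.

(** At least the integers [M] and [M + 1] are missing after the middle block,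
    which ends with [M - 1], so the cells leave the space between [M / p] and
    [(M + 1) / p] free; the point chosen is the middle of that space. *)
Lemma notS2_hole : ~ S2 l1 r1 l2 r2 p -> exists2 z : R, 0 < z < 1 & ~ D z.
Proof.
move=> ns2; pose M := maxn l1 r2; exists ((M%:R + 2^-1) / p%:R).
  rewrite ltr_pdivlMr// ltr_pdivrMr// mul0r mul1r.
  have : (M + 1 <= p)%N by lia.
  by rewrite -(ler_nat R) natrD; have := ler0n R M; lra.
apply: not_diff_radix => d /diff_digitsP Ad.
have [] : d <= M%:Z - 1 \/ M%:Z + 2 <= d.
  by move: ns2; rewrite /S2; case: Ad; lia.
  rewrite -(ler_int R) rmorphB/= mulrC divfK ?gt_eqF// -pmulrn; lra.
rewrite -(ler_int R) rmorphD/= mulrC divfK ?gt_eqF// -pmulrn -[2%:~R]/(2%:R); lra.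
Qed.

(** Modulo [p] the left and right blocks form [1, l1 + r2 - 1] and
    [p + 1 - r1 - l2, p - 1], which overlap or are adjacent; 0 is in the middle
    block. *)
Lemma notS3_interval : ~ S3 l1 r1 l2 r2 p ->
  exists u v : R, u < v /\ forall y, u <= y <= v -> D y.
Proof.
rewrite /S3 => s3; apply: residues_interval => // m.
have := divz_eq m p; have := modz_ge0 m (d := p%:Z); have := ltz_mod m (d := p%:Z).
set q := (m %/ p)%Z; set r := (m %% p)%Z => r_lt r_ge mE.
have [r0|[r_le|r_gt]] : r = 0 \/ 1 <= r <= l1%:Z + r2%:Z - 1 \/ l1%:Z + r2%:Z <= r.
  by lia.
- exists 0; first by apply/diff_digitsP/Or42; lia.
  by rewrite mE r0; apply/dvdzP; exists q; ring.
- exists (r - p%:Z); first by apply/diff_digitsP/Or41; lia.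
  by rewrite mE; apply/dvdzP; exists (q + 1); ring.
- exists r; first by apply/diff_digitsP/Or44; lia.
  by rewrite mE; apply/dvdzP; exists q; ring.
Qed.

(** Let [z] be a hole of the positive part of [D] and [a = l1 + r2]. Modulo [p]
    the integer [a] is not a digit, so for every integer [j] the
    only digit that can be stripped from [a - 1 + z + p j] is [a - 1 + p j],
    and this leaves [z]. *)
Lemma S3_translate : S3 l1 r1 l2 r2 p ->
  exists w : R, forall j : int, ~ D (w + j%:~R).
Proof.
rewrite /S3 => s3; have [|z z01 nDz] := notS2_hole; first by rewrite /S2; lia.
pose a := (l1 + r2)%N.
have aE : a%:~R = a%:R :> R by rewrite -pmulrn.
exists ((a%:R - 1 + z) / p%:R) => j.
have pw : p%:R * ((a%:R - 1 + z) / p%:R + j%:~R) = a%:R - 1 + z + p%:R * j%:~R.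
  by field; rewrite gt_eqF.
apply: not_diff_radix => d Ad; rewrite pw => d1 Dd.
pose i := a%:Z - 1 + p%:Z * j - d.
have iE : i%:~R = a%:R - 1 + p%:R * j%:~R - d%:~R :> R.
  by rewrite /i rmorphB rmorphD rmorphB rmorphM/= aE pZ.
have i01 : -2 < i < 1.
  by rewrite -!(ltr_int R) iE rmorphN/= -[2%:~R]/(2%:R); lra.
have [i0|iN1] : i = 0 \/ i = -1 by lia.
  apply: nDz; rewrite -[z]add0r -[0 in X in D X]/(0%:~R) -i0 iE.
  by move: Dd; congr (D _); ring.
have dE : d = a%:Z + p%:Z * j by rewrite -[d](subKr (a%:Z - 1 + p%:Z * j)) -/i iN1; ring.
have := Ad; rewrite dE /a => /diff_digitsP.
have [j_le|[->|[->|j_ge]]] : j <= -2 \/ j = -1 \/ j = 0 \/ 1 <= j by lia.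
- by case; nia.
- by case; lia.
- by case; lia.
- by case; nia.
Qed.

Lemma S3_Cantor : S3 l1 r1 l2 r2 p -> is_Cantor_set D.
Proof.
move=> /S3_translate[w wD]; split.
- by exists 1.
- apply: (subclosed_compact D_closed (@segment_compact R (-1) 1)).
  by move=> z /D_range /=; rewrite in_itv.
- exact: perfect_radix_set.
rewrite /nowhere_dense -(closure_id _).1// -subset0 => x /nbhs_ballP[e /= e0 eD].
have [||j] := @interval_translates R p A p_gt1 (x - e / 2) (x + e / 2) _ _ w.
- lra.
- by move=> y y_x; apply: eD; rewrite /ball/= ltr_norml; lra.
exact: wD.
Qed.

(** Without (S2-star) the integer [M] after the middle block is not a digit, so
    the cell of [M + 1] alone can reach the points between [M / p] and
    [(M + 1) / p]: there the negative part of [D] is reproduced, with its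
    holes. *)
Lemma touching_hole : ~ S2star l1 r1 l2 r2 p ->
  (exists2 y : R, -1 < y < 0 & ~ D y) -> exists2 z : R, 0 < z < 1 & ~ D z.
Proof.
move=> ns2 [y y01 nDy]; pose M := maxn l1 r2.
exists ((M%:R + 1 + y) / p%:R).
  rewrite ltr_pdivlMr// ltr_pdivrMr// mul0r mul1r.
  have : (M + 1 <= p)%N by lia.
  by rewrite -(ler_nat R) natrD; have := ler0n R M; lra.
apply: not_diff_radix => d /diff_digitsP Ad; rewrite mulrC divfK ?gt_eqF//.
have [d_le|[->|d_ge]] : d <= M%:Z - 1 \/ d = M%:Z + 1 \/ M%:Z + 2 <= d.
- by move: ns2; rewrite /S2star; case: Ad; lia.
- by move: d_le; rewrite -(ler_int R) rmorphB/= -pmulrn; lra.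
- by rewrite rmorphD/= -pmulrn addrAC subrr add0r.
- by move: d_ge; rewrite -(ler_int R) rmorphD/= -pmulrn -[2%:~R]/(2%:R); lra.
Qed.

Lemma left_gap_ends_cluster : ~ S3 l1 r1 l2 r2 p ->
  (exists2 z : R, 0 < z < 1 & ~ D z) ->
  forall G a, gaps D G -> left_endpoint G a -> gaps_and_components_cluster_at D a.
Proof.
move=> /notS3_interval[u [v [uv uvD]]] [z z01 nDz] G a DG Ga.
have [Da [g g0 hole]] := gap_left_endpointP D_closed DG Ga.
apply: (left_end_clusters g0 hole).
  apply: (gap_left_holes p_gt1 A_le A_max g0 hole) => D01.
  by apply/nDz/D01; lra.
by move=> e; exact: (interval_near p_gt1 A_le uv uvD Da).
Qed.

Lemma left_gap_ends_proper : S2star l1 r1 l2 r2 p ->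
  forall G a, gaps D G -> left_endpoint G a -> ends_proper_component D a.
Proof.
move=> /S2star_nonneg D01 G a DG Ga.
have [Da [g g0 hole]] := gap_left_endpointP D_closed DG Ga.
have [e e0 eD] := gap_left_interval p_gt1 A_le A_max Da g0 hole D01.
exact: left_end_proper g0 hole e0 eD.
Qed.

Lemma diff_radix_perfect : perfect_set D.
Proof. exact: perfect_radix_set. Qed.

Lemma diff_radix_bounds : [/\ forall z, D z -> -1 <= z <= 1, D 1 & D (-1)].
Proof. by []. Qed.

End DiffDigits.

(** * Classification *)

Lemma cluster_infinite_gaps (R : realType) (E : set R) (a : R) :
  gaps_and_components_cluster_at E a -> infinite_set (gaps E).
Proof.
move=> [/(_ setT filterT) inf_a _] fin; apply: inf_a.
by apply: sub_finite_set fin => K [].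
Qed.

Section Classification.
Variables (R : realType) (l1 r1 l2 r2 p : nat).
Hypotheses (l1_gt0 : (0 < l1)%N) (r1_gt0 : (0 < r1)%N).
Hypotheses (l2_gt0 : (0 < l2)%N) (r2_gt0 : (0 < r2)%N) (p_gt2 : (2 < p)%N).
Hypotheses (lr1_lt_p : (l1 + r1 < p)%N) (lr2_lt_p : (l2 + r2 < p)%N).

Local Notation D := (radix_set (diff_digits l1 r1 l2 r2 p) p : set R).
Local Notation D' := (radix_set (diff_digits l2 r2 l1 r1 p) p : set R).

Lemma diff_radix_mirror : mirror D = D'.
Proof.
rewrite -!diff_Cset//; apply/seteqP; split=> [x [a aC [b bC abx]]|_ [b bC [a aC <-]]].
  by exists b => //; exists a => //; rewrite -[x]opprK -abx opprB.
by exists a => //; exists b => //; rewrite opprB.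
Qed.

Lemma right_gap_ends_cluster : ~ S3 l1 r1 l2 r2 p ->
  (exists2 z : R, 0 < z < 1 & ~ D' z) ->
  forall G a, gaps D G -> right_endpoint G a -> gaps_and_components_cluster_at D a.
Proof.
move=> ns3 hole G a DG Ga; have [] := right_end_gap_mirror DG Ga.
rewrite diff_radix_mirror => mDG mGa.
rewrite -(opprK a); apply: cluster_at_mirror; rewrite diff_radix_mirror.
by apply: left_gap_ends_cluster mDG mGa => //; move: ns3; rewrite /S3; lia.
Qed.

Lemma right_gap_ends_proper : S1star l1 r1 l2 r2 p ->
  forall G a, gaps D G -> right_endpoint G a -> ends_proper_component D a.
Proof.
move=> s1 G a DG Ga; have [] := right_end_gap_mirror DG Ga.
rewrite diff_radix_mirror => mDG mGa.
rewrite -(opprK a); apply: ends_proper_mirror; rewrite diff_radix_mirror.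
by apply: left_gap_ends_proper mDG mGa => //; move: s1; rewrite /S1star /S2star; lia.
Qed.

Lemma notS1_hole : ~ S1 l1 r1 l2 r2 p -> exists2 z : R, 0 < z < 1 & ~ D' z.
Proof. by move=> ns1; apply: notS2_hole => //; move: ns1; rewrite /S1 /S2; lia. Qed.

Lemma positive_hole : ~ S2star l1 r1 l2 r2 p ->
  ~ S1 l1 r1 l2 r2 p \/ ~ S2 l1 r1 l2 r2 p -> exists2 z : R, 0 < z < 1 & ~ D z.
Proof.
move=> ns2s [/notS1_hole|ns2]; last exact: notS2_hole.
rewrite -diff_radix_mirror => -[z z01 nDz]; apply: touching_hole => //.
by exists (- z) => //; lra.
Qed.

Lemma negative_hole : ~ S1star l1 r1 l2 r2 p ->
  ~ S1 l1 r1 l2 r2 p \/ ~ S2 l1 r1 l2 r2 p -> exists2 z : R, 0 < z < 1 & ~ D' z.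
Proof.
move=> ns1s [/notS1_hole//|ns2].
have [z z01 nDz] : exists2 z : R, 0 < z < 1 & ~ D z by exact: notS2_hole.
apply: touching_hole => //; first by move: ns1s; rewrite /S1star /S2star; lia.
exists (- z); first lra.
by rewrite -diff_radix_mirror /mirror/= opprK.
Qed.

Lemma L_Cantorval_of : S1star l1 r1 l2 r2 p -> ~ S2 l1 r1 l2 r2 p ->
  is_L_Cantorval D.
Proof.
move=> s1 ns2; have ns3 : ~ S3 l1 r1 l2 r2 p by move: s1; rewrite /S1star /S3; lia.
have [range D1 _] : [/\ forall z, D z -> -1 <= z <= 1, D 1 & D (-1)].
  exact: diff_radix_bounds.
have left_ends G a : gaps D G -> left_endpoint G a ->
    gaps_and_components_cluster_at D a.
  by apply: left_gap_ends_cluster => //; exact: notS2_hole.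
split=> //; first exact: diff_radix_perfect.
  by have [G /left_ends/[apply]/cluster_infinite_gaps] := gap_left_of_1 range D1.
exact: right_gap_ends_proper.
Qed.

Lemma R_Cantorval_of : S2star l1 r1 l2 r2 p -> ~ S1 l1 r1 l2 r2 p ->
  is_R_Cantorval D.
Proof.
move=> s2 ns1; have ns3 : ~ S3 l1 r1 l2 r2 p by move: s2; rewrite /S2star /S3; lia.
have [range _ DN1] : [/\ forall z, D z -> -1 <= z <= 1, D 1 & D (-1)].
  exact: diff_radix_bounds.
have right_ends G a : gaps D G -> right_endpoint G a ->
    gaps_and_components_cluster_at D a.
  by apply: right_gap_ends_cluster => //; exact: notS1_hole.
split=> //; first exact: diff_radix_perfect.
  by have [G /right_ends/[apply]/cluster_infinite_gaps] := gap_right_of_N1 range DN1.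
exact: left_gap_ends_proper.
Qed.

Lemma M_Cantorval_of : ~ S1star l1 r1 l2 r2 p -> ~ S2star l1 r1 l2 r2 p ->
  ~ S3 l1 r1 l2 r2 p -> ~ S1 l1 r1 l2 r2 p \/ ~ S2 l1 r1 l2 r2 p ->
  is_M_Cantorval D.
Proof.
move=> ns1s ns2s ns3 ns12.
have [range D1 _] : [/\ forall z, D z -> -1 <= z <= 1, D 1 & D (-1)].
  exact: diff_radix_bounds.
have left_ends G a : gaps D G -> left_endpoint G a ->
    gaps_and_components_cluster_at D a.
  by apply: left_gap_ends_cluster => //; exact: positive_hole.
have right_ends G a : gaps D G -> right_endpoint G a ->
    gaps_and_components_cluster_at D a.
  by apply: right_gap_ends_cluster => //; exact: negative_hole.
split; first exact: diff_radix_perfect.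
  by have [G /left_ends/[apply]/cluster_infinite_gaps] := gap_left_of_1 range D1.
by move=> G a DG [/(left_ends _ _ DG)|/(right_ends _ _ DG)].
Qed.

End Classification.

Unset Implicit Arguments.
Set Strict Implicit.

Theorem theorem2p7 (R : realType) (l1 r1 l2 r2 p : nat)
  (l1_gt0 : (0 < l1)%N) (r1_gt0 : (0 < r1)%N)
  (l2_gt0 : (0 < l2)%N) (r2_gt0 : (0 < r2)%N) (p_gt2 : (2 < p)%N)
  (lr1_lt_p : (l1 + r1 < p)%N) (lr2_lt_p : (l2 + r2 < p)%N) :
  let D : set R := diff_set (Cset R l1 r1 p) (Cset R l2 r2 p) in
  [/\ D = [set x | -1 <= x <= 1] <->
        S1 l1 r1 l2 r2 p /\ S2 l1 r1 l2 r2 p,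
      is_Cantor_set D <-> S3 l1 r1 l2 r2 p,
      is_L_Cantorval D <-> S1star l1 r1 l2 r2 p /\ ~ S2 l1 r1 l2 r2 p,
      is_R_Cantorval D <-> S2star l1 r1 l2 r2 p /\ ~ S1 l1 r1 l2 r2 p &
      is_M_Cantorval D <->
        [/\ ~ S1star l1 r1 l2 r2 p, ~ S2star l1 r1 l2 r2 p,
            ~ S3 l1 r1 l2 r2 p &
            ~ S1 l1 r1 l2 r2 p \/ ~ S2 l1 r1 l2 r2 p]].
Proof.
move=> D.
have DE : D = radix_set (diff_digits l1 r1 l2 r2 p) p by exact: diff_Cset.
have [range D1 DN1] : [/\ forall z, D z -> -1 <= z <= 1, D 1 & D (-1)].
  by rewrite DE; exact: diff_radix_bounds.
have itv_of := S1_S2_cover R l1_gt0 r1_gt0 l2_gt0 r2_gt0 p_gt2 lr1_lt_p lr2_lt_p.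
have C_of := S3_Cantor R l1_gt0 r1_gt0 l2_gt0 r2_gt0 p_gt2 lr1_lt_p lr2_lt_p.
have L_of := L_Cantorval_of R l1_gt0 r1_gt0 l2_gt0 r2_gt0 p_gt2 lr1_lt_p lr2_lt_p.
have R_of := R_Cantorval_of R l1_gt0 r1_gt0 l2_gt0 r2_gt0 p_gt2 lr1_lt_p lr2_lt_p.
have M_of := M_Cantorval_of R l1_gt0 r1_gt0 l2_gt0 r2_gt0 p_gt2 lr1_lt_p lr2_lt_p.
rewrite -DE in itv_of C_of L_of R_of M_of.
have I_ends := itv_ends range.
have C_ends1 := @Cantor_ends R D ^~ 1.
have C_endsN1 := @Cantor_ends R D ^~ (-1).
have L_ends := L_Cantorval_ends range D1 DN1.
have R_ends := R_Cantorval_ends range D1 DN1.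
have M_ends := M_Cantorval_ends range D1 DN1.
have excl1 := proper_not_cluster_1 range D1.
have exclN1 := proper_not_cluster_N1 range DN1.
have cases : (S1 l1 r1 l2 r2 p /\ S2 l1 r1 l2 r2 p) \/ S3 l1 r1 l2 r2 p \/
    (S1star l1 r1 l2 r2 p /\ ~ S2 l1 r1 l2 r2 p) \/
    (S2star l1 r1 l2 r2 p /\ ~ S1 l1 r1 l2 r2 p) \/
    (~ S1star l1 r1 l2 r2 p /\ ~ S2star l1 r1 l2 r2 p /\ ~ S3 l1 r1 l2 r2 p /\
      (~ S1 l1 r1 l2 r2 p \/ ~ S2 l1 r1 l2 r2 p)).
  by rewrite /S1 /S2 /S3 /S1star /S2star; clear; lia.
rewrite (_ : [/\ _, _, _ & _] = (~ S1star l1 r1 l2 r2 p /\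
    ~ S2star l1 r1 l2 r2 p /\ ~ S3 l1 r1 l2 r2 p /\
    (~ S1 l1 r1 l2 r2 p \/ ~ S2 l1 r1 l2 r2 p))); last first.
  by apply/propext; split=> [[]|[? [? []]]].
move: itv_of C_of L_of R_of M_of I_ends C_ends1 C_endsN1 L_ends R_ends M_ends.
move: excl1 exclN1 cases; clear.
by split; tauto.
Qed.
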